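(* Let $\alpha\in\mathbb R\setminus\{0,1\}$. Suppose either $\lambda=\alpha$ with $\alpha\notin\mathbb N$, or $\lambda=1$ with $\alpha^{-1}\notin\mathbb N$. Then the Bessel–Fischer product is non-degenerate on $\mathcal F_\lambda$: if $p\in\mathcal F_\lambda$ satisfies $\langle p,q\rangle_{\mathcal B}=0$ for all $q\in\mathcal F_\lambda$, then $p=0$.
   Context: $\mathbb N=\{0,1,2,\dots\}$. $\mathcal P(\mathbb C^{2|2})=\mathbb C[z_1,z_2]\otimes\Lambda(z_3,z_4)$, with $z_1,z_2$ even and $z_3,z_4$ odd; $\partial_i=\partial_{z_i}$ are the (left) partial superderivatives. The Bessel operators are $\mathcal B_\lambda(z_1)=(-\lambda+z_1\partial_1+z_3\partial_3+z_4\partial_4)\partial_1-2\alpha z_2\partial_3\partial_4$, $\mathcal B_\lambda(z_2)=(-\tfrac{\lambda}{\alpha}+z_2\partial_2+z_3\partial_3+z_4\partial_4)\partial_2-2z_1\partial_3\partial_4$, $\mathcal B_\lambda(z_3)=(-2\lambda+2z_1\partial_1+2\alpha z_2\partial_2+2(1+\alpha)z_3\partial_3)\partial_4+z_3\partial_1\partial_2$, $\mathcal B_\lambda(z_4)=(2\lambda-2z_1\partial_1-2\alpha z_2\partial_2-2(1+\alpha)z_4\partial_4)\partial_3+z_4\partial_1\partial_2$. They supercommute. $\mathcal I_\lambda$ is the ideal of $\mathcal P(\mathbb C^{2|2})$ generated by $2z_1z_2+z_3z_4,\ z_2^2,\ z_2z_3,\ z_2z_4$ if $\lambda=\alpha$,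 and by $2\alpha z_1z_2+z_3z_4,\ z_1^2,\ z_1z_3,\ z_1z_4$ if $\lambda=1$. The polynomial Fock space is $\mathcal F_\lambda=\mathcal P(\mathbb C^{2|2})/\mathcal I_\lambda$. The Bessel–Fischer product is $\langle p,q\rangle_{\mathcal B}=p(\mathcal B_\lambda)\,\bar q(z)|_{z=0}$, where $p(\mathcal B_\lambda)$ is obtained by replacing each monomial $z_1^{\gamma_1}z_2^{\gamma_2}z_3^{\gamma_3}z_4^{\gamma_4}$ of $p$ by $\mathcal B_\lambda(z_1)^{\gamma_1}\mathcal B_\lambda(z_2)^{\gamma_2}\mathcal B_\lambda(z_3)^{\gamma_3}\mathcal B_\lambda(z_4)^{\gamma_4}$ and $\bar q$ is obtained by conjugating the coefficients of $q$. It vanishes when either argument lies in $\mathcal I_\lambda$, hence is well defined on $\mathcal F_\lambda$. *)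

(* Defs.v *)
From HB Require Import structures.
From mathcomp Require Import all_boot all_order all_algebra.
From mathcomp Require Import generic_quotient ring_quotient.
From mathcomp Require Import complex boolp reals mpoly ring.

Set Implicit Arguments.
Unset Strict Implicit.
Unset Printing Implicit Defensive.

Import GRing.Theory.
Local Open Scope ring_scope.
Local Open Scope complex_scope.

(* The superalgebra K[z1,z2] (x) Lambda(z3,z4):
   SuperPoly f0 f3 f4 f34 stands for f0 + f3 z3 + f4 z4 + f34 z3 z4.
   The even variables z1, z2 are the variables 0, 1 of {mpoly K[2]}. *)
Record superpoly (K : comNzRingType) := SuperPoly {
  sp0 : {mpoly K[2]};
  sp3 : {mpoly K[2]};
  sp4 : {mpoly K[2]};
  sp34 : {mpoly K[2]} }.

Section SuperpolyAlgebra.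
Variable K : comNzRingType.
Local Notation P := (superpoly K).
Implicit Types f g h : P.

Lemma superpoly_eq f g : sp0 f = sp0 g -> sp3 f = sp3 g ->
  sp4 f = sp4 g -> sp34 f = sp34 g -> f = g.
Proof. by case: f g => ? ? ? ? [? ? ? ?] /= -> -> -> ->. Qed.

Definition superpoly_tuple f := (sp0 f, sp3 f, sp4 f, sp34 f).
Definition tuple_superpoly
    (t : {mpoly K[2]} * {mpoly K[2]} * {mpoly K[2]} * {mpoly K[2]}) : P :=
  let: (a, b, c, d) := t in SuperPoly a b c d.
Lemma superpoly_tupleK : cancel superpoly_tuple tuple_superpoly.
Proof. by case. Qed.
HB.instance Definition _ := Choice.copy P (can_type superpoly_tupleK).

Definition sp_zero : P := SuperPoly 0 0 0 0.
Definition sp_opp f : P :=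
  SuperPoly (- sp0 f) (- sp3 f) (- sp4 f) (- sp34 f).
Definition sp_add f g : P :=
  SuperPoly (sp0 f + sp0 g) (sp3 f + sp3 g) (sp4 f + sp4 g) (sp34 f + sp34 g).

Fact sp_addA : associative sp_add.
Proof. by move=> f g h; apply: superpoly_eq => /=; rewrite addrA. Qed.
Fact sp_addC : commutative sp_add.
Proof. by move=> f g; apply: superpoly_eq => /=; rewrite addrC. Qed.
Fact sp_add0 : left_id sp_zero sp_add.
Proof. by move=> f; apply: superpoly_eq => /=; rewrite add0r. Qed.
Fact sp_addN : left_inverse sp_zero sp_opp sp_add.
Proof. by move=> f; apply: superpoly_eq => /=; rewrite addNr. Qed.
HB.instance Definition _ :=
  GRing.isZmodule.Build P sp_addA sp_addC sp_add0 sp_addN.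

(* z3^2 = z4^2 = 0 and z4 z3 = - z3 z4 *)
Definition sp_one : P := SuperPoly 1 0 0 0.
Definition sp_mul f g : P := SuperPoly
  (sp0 f * sp0 g)
  (sp0 f * sp3 g + sp3 f * sp0 g)
  (sp0 f * sp4 g + sp4 f * sp0 g)
  (sp0 f * sp34 g + sp34 f * sp0 g + sp3 f * sp4 g - sp4 f * sp3 g).

Fact sp_mulA : associative sp_mul.
Proof. by move=> f g h; apply: superpoly_eq => /=; ring. Qed.
Fact sp_mul1l : left_id sp_one sp_mul.
Proof. by move=> f; apply: superpoly_eq => /=; ring. Qed.
Fact sp_mul1r : right_id sp_one sp_mul.
Proof. by move=> f; apply: superpoly_eq => /=; ring. Qed.
Fact sp_mulDl : left_distributive sp_mul sp_add.
Proof. by move=> f g h; apply: superpoly_eq => /=; ring. Qed.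
Fact sp_mulDr : right_distributive sp_mul sp_add.
Proof. by move=> f g h; apply: superpoly_eq => /=; ring. Qed.
Fact sp_one_neq0 : sp_one != sp_zero.
Proof. by apply/eqP => /(congr1 (@sp0 K)) /eqP; rewrite oner_eq0. Qed.
HB.instance Definition _ := GRing.Zmodule_isNzRing.Build P
  sp_mulA sp_mul1l sp_mul1r sp_mulDl sp_mulDr sp_one_neq0.

Definition sp_scale (c : K) f : P :=
  SuperPoly (c *: sp0 f) (c *: sp3 f) (c *: sp4 f) (c *: sp34 f).

Fact sp_scaleA c d f : sp_scale c (sp_scale d f) = sp_scale (c * d) f.
Proof. by apply: superpoly_eq => /=; rewrite scalerA. Qed.
Fact sp_scale1 : left_id 1 sp_scale.
Proof. by move=> f; apply: superpoly_eq => /=; rewrite scale1r. Qed.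
Fact sp_scaleDr : right_distributive sp_scale +%R.
Proof. by move=> c f g; apply: superpoly_eq => /=; rewrite scalerDr. Qed.
Fact sp_scaleDl f : {morph sp_scale^~ f : c d / c + d}.
Proof. by move=> c d; apply: superpoly_eq => /=; rewrite scalerDl. Qed.
HB.instance Definition _ := GRing.Zmodule_isLmodule.Build K P
  sp_scaleA sp_scale1 sp_scaleDr sp_scaleDl.

Definition z1 : P := SuperPoly 'X_0 0 0 0.
Definition z2 : P := SuperPoly 'X_1 0 0 0.
Definition z3 : P := SuperPoly 0 1 0 0.
Definition z4 : P := SuperPoly 0 0 1 0.

Definition d1 f : P :=
  SuperPoly (sp0 f)^`M(0) (sp3 f)^`M(0) (sp4 f)^`M(0) (sp34 f)^`M(0).
Definition d2 f : P :=
  SuperPoly (sp0 f)^`M(1) (sp3 f)^`M(1) (sp4 f)^`M(1) (sp34 f)^`M(1).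
(* Odd left derivatives: d3 (z3 z4) = z4 and d4 (z3 z4) = - z3. *)
Definition d3 f : P := SuperPoly (sp3 f) 0 (sp34 f) 0.
Definition d4 f : P := SuperPoly (sp4 f) (- sp34 f) 0 0.

Definition sp_eval0 f : K := (sp0 f)@_0%MM.

(* (\sum_m p_m z1^m0 z2^m1) with z1, z2 replaced by the operators D1, D2 *)
Definition even_subst (D1 D2 : P -> P) (p : {mpoly K[2]}) f : P :=
  \sum_(m <- msupp p) p@_m *: iter (m 0) D1 (iter (m 1) D2 f).

Definition super_subst (D1 D2 D3 D4 : P -> P) (p : P) f : P :=
  even_subst D1 D2 (sp0 p) f + even_subst D1 D2 (sp3 p) (D3 f)
  + even_subst D1 D2 (sp4 p) (D4 f) + even_subst D1 D2 (sp34 p) (D3 (D4 f)).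

End SuperpolyAlgebra.

Arguments z1 {K}.
Arguments z2 {K}.
Arguments z3 {K}.
Arguments z4 {K}.

Section Bessel.
Variables (K : fieldType) (a l : K).
Implicit Types f : superpoly K.

Definition bessel1 f :=
  let g := d1 f in
  - l *: g + z1 * d1 g + z3 * d3 g + z4 * d4 g
  - (2 * a) *: (z2 * d3 (d4 f)).

Definition bessel2 f :=
  let g := d2 f in
  - (l / a) *: g + z2 * d2 g + z3 * d3 g + z4 * d4 g
  - 2 *: (z1 * d3 (d4 f)).

Definition bessel3 f :=
  let g := d4 f in
  - (2 * l) *: g + 2 *: (z1 * d1 g) + (2 * a) *: (z2 * d2 g)
  + (2 * (1 + a)) *: (z3 * d3 g)
  + z3 * d1 (d2 f).

Definition bessel4 f :=
  let g := d3 f in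
  (2 * l) *: g - 2 *: (z1 * d1 g) - (2 * a) *: (z2 * d2 g)
  - (2 * (1 + a)) *: (z4 * d4 g)
  + z4 * d1 (d2 f).

Definition bessel_subst : superpoly K -> superpoly K -> superpoly K :=
  super_subst bessel1 bessel2 bessel3 bessel4.

End Bessel.

Section GeneratedIdeal.
Variable A : nzRingType.

Definition two_sided_ideal (J : A -> Prop) : Prop :=
  [/\ J 0, forall x y, J x -> J y -> J (x + y)
    & forall u x v, J x -> J (u * x * v)].

Definition ideal_gen (s : seq A) : A -> bool := fun x =>
  `[< forall J, two_sided_ideal J -> (forall g, g \in s -> J g) -> J x >].

Fact ideal_gen_zmod_closed s : zmod_closed (ideal_gen s).
Proof.
split=> [|x y /asboolP xI /asboolP yI]; apply/asboolP => J idJ sJ.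
  by case: idJ.
have [_ JD JM] := idJ; apply: JD; first exact: xI.
by rewrite -mulN1r -[_ * y]mulr1; apply: JM; apply: yI.
Qed.
HB.instance Definition _ s :=
  GRing.isZmodClosed.Build A (ideal_gen s) (ideal_gen_zmod_closed s).

End GeneratedIdeal.

Section Fock.
Variables (R : realType) (alpha lambda : R).
Local Notation P := (superpoly R[i]).

Definition fock_gens : seq P :=
  if lambda == alpha then
    [:: 2 *: (z1 * z2) + z3 * z4; z2 ^+ 2; z2 * z3; z2 * z4]
  else if lambda == 1 then
    [:: (2 * alpha%:C) *: (z1 * z2) + z3 * z4; z1 ^+ 2; z1 * z3; z1 * z4]
  else [::]. (* junk: I_lambda is defined for lambda = alpha or 1 only *)

Definition fock_ideal : zmodClosed P :=
  GRing.ZmodClosed.clone P (ideal_gen fock_gens) _.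

Definition fock := {ideal_quot fock_ideal}.
HB.instance Definition _ := GRing.Zmodule.on fock.
HB.instance Definition _ := Quotient.on fock.

Definition sp_conj (q : P) : P :=
  SuperPoly (map_mpoly (@conjc R) (sp0 q)) (map_mpoly (@conjc R) (sp3 q))
            (map_mpoly (@conjc R) (sp4 q)) (map_mpoly (@conjc R) (sp34 q)).

Definition bessel_fischer (p q : P) : R[i] :=
  sp_eval0 (bessel_subst alpha%:C lambda%:C p (sp_conj q)).

(* Computed on representatives: for alpha != 0 and lambda = alpha or 1,
   bessel_fischer vanishes as soon as one argument lies in fock_ideal. *)
Definition fock_bessel_fischer (p q : fock) : R[i] :=
  lift_fun2 fock bessel_fischer p q.

End Fock.

(* Main.v *)
Require Import Defs.
From mathcomp Require Import all_boot all_order all_algebra.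
From mathcomp Require Import complex reals.
From mathcomp Require Import generic_quotient ring_quotient boolp mpoly ring.

(** In the quotient by the ideal, one even variable survives with all its
powers and the other is nearly nilpotent.  Write z_o for the long variable
and z_s for the short one: (o, s) = (1, 2) when lambda = alpha, and
(o, s) = (2, 1) when lambda = 1.  With t = 1, resp. t = alpha, the ideal is
generated by 2 t z_o z_s + z3 z4, z_s^2, z_s z3 and z_s z4, so a class in the
quotient is determined by its four sequences of coordinates
  a_k : coefficient of z_o^k,      b_k : coefficient of z_o^k z_s,
  c_k : coefficient of z_o^k z3,   d_k : coefficient of z_o^k z4,
taken after z3 z4 has been replaced by - 2 t z_o z_s; in other words, the ideal
is the common kernel of these linear forms ([ideal_gen_vanishing]).

With mu = alpha, resp. mu = 1 / alpha, both cases become one family of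
operators, and these act on the coordinates by explicit rules:
  a_k (B_o f) = (k + 1) (k - mu) a_(k+1) f,   likewise for b_k;
  a_k (B_s f) = - b_k f,                      b_k (B_s f) = 0;
  a_k (B_3 f) = 2 t (k - mu) d_k f,           b_k (B_3 f) = 0;
  a_k (B_4 f) = - 2 t (k - mu) c_k f,         b_k (B_4 f) = 0,
                                              d_k (B_4 f) = (k + 1) b_(k+1) f.
Evaluation at 0 is a_0, so each word in the operators is evaluated by these
rules.  Put w_k = prod_(j < k) (j + 1) (j - mu).  Summing over the monomials
of p gives ([pairingE])
  sum_k w_k (a_k p a_k f - b_k p b_k f
             + 2 t (k - mu) (c_k p d_k f - d_k p c_k f)).
This is block diagonal in the coordinates, and its coefficients vanish only if
mu is a natural number.  Hence pairing p with z_o^n, z_o^n z_s, z_o^n z3 and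
z_o^n z4 recovers all coordinates of p, and a p in the radical lies in the
ideal.  The formula involves f only through its coordinates, so replacing a
test monomial by another representative of its class changes nothing. *)

Set Implicit Arguments.
Unset Strict Implicit.
Unset Printing Implicit Defensive.

Import GRing.Theory Num.Theory.
Local Open Scope ring_scope.

(** * Monomials in a long and a short variable *)

Section Monomials.
Variables (K : comNzRingType) (o s : 'I_2).
Hypothesis os : o != s.
Implicit Types p q : {mpoly K[2]}.

Definition mon k j : 'X_{1..2} := (U_(o) *+ k + U_(s) *+ j)%MM.

Lemma mon_o k j : mon k j o = k.
Proof. by rewrite /mon mnmDE !mulmnE !mnm1E eqxx eq_sym (negbTE os) mul1n addn0. Qed.

Lemma mon_s k j : mon k j s = j.
Proof. by rewrite /mon mnmDE !mulmnE !mnm1E eqxx (negbTE os) mul1n. Qed.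

Lemma monP (m : 'X_{1..2}) : m = mon (m o) (m s).
Proof.
apply/mnmP => i; have [->|io] := eqVneq i o; first by rewrite mon_o.
suff -> : i = s by rewrite mon_s.
move: os io; case: (o) => [[|[|?]] ?] //; case: (s) => [[|[|?]] ?] //;
  case: (i) => [[|[|?]] ?] // *; exact/val_inj.
Qed.

Lemma mon_inj k j k' j' : (mon k j == mon k' j') = (k == k') && (j == j').
Proof.
apply/eqP/andP => [e|[/eqP -> /eqP ->] //].
by rewrite -(mon_o k j) -{2}(mon_s k j) e mon_o mon_s !eqxx.
Qed.

Lemma mon00 : mon 0 0 = 0%MM.
Proof. by rewrite /mon !mulm0n addm0. Qed.

Lemma monDo k j : (mon k j + U_(o))%MM = mon k.+1 j.
Proof. by rewrite /mon mulmS addmC addmA. Qed.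

Lemma monDs k j : (mon k j + U_(s))%MM = mon k j.+1.
Proof. by rewrite /mon mulmS -!addmA [(U_(s) + _)%MM]addmC. Qed.

Lemma mcoeff_deriv_o p k j : p^`M(o)@_(mon k j) = p@_(mon k.+1 j) *+ k.+1.
Proof. by rewrite mcoeff_deriv monDo mon_o. Qed.

Lemma mcoeff_deriv_s p k j : p^`M(s)@_(mon k j) = p@_(mon k j.+1) *+ j.+1.
Proof. by rewrite mcoeff_deriv monDs mon_s. Qed.

Lemma mcoeff_Xo p k j : ('X_o * p)@_(mon k.+1 j) = p@_(mon k j).
Proof. by rewrite mulrC -monDo addmC mcoeffMX. Qed.

Lemma mcoeff_Xs p k j : ('X_s * p)@_(mon k j.+1) = p@_(mon k j).
Proof. by rewrite mulrC -monDs addmC mcoeffMX. Qed.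

Lemma mcoeff_X0 i p (m : 'X_{1..2}) : m i = 0%N -> ('X_i * p)@_m = 0.
Proof.
move=> mi; rewrite mcoeffM big1 // => k /eqP mk.
rewrite mcoeffX; case: eqP => [ki|_]; last by rewrite mul0r.
by move/mnmP/(_ i): mk; rewrite mi mnmDE -ki mnm1E eqxx.
Qed.

Lemma mcoeff_Xo0 p j : ('X_o * p)@_(mon 0 j) = 0.
Proof. by rewrite mcoeff_X0 ?mon_o. Qed.

Lemma mcoeff_Xs0 p k : ('X_s * p)@_(mon k 0) = 0.
Proof. by rewrite mcoeff_X0 ?mon_s. Qed.

Lemma mcoeff_euler_o p k j : ('X_o * p^`M(o))@_(mon k j) = p@_(mon k j) *+ k.
Proof. by case: k => [|k]; rewrite ?mcoeff_Xo0 ?mulr0n // mcoeff_Xo mcoeff_deriv_o. Qed.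

Lemma mcoeff_euler_s p k j : ('X_s * p^`M(s))@_(mon k j) = p@_(mon k j) *+ j.
Proof. by case: j => [|j]; rewrite ?mcoeff_Xs0 ?mulr0n // mcoeff_Xs mcoeff_deriv_s. Qed.

(** Each monomial of [p] is a multiple of z_s, and the quotient shifts its
exponent. *)
Lemma dvd_Xs p : (forall k, p@_(mon k 0) = 0) -> exists q, p = 'X_s * q.
Proof.
move=> p0; exists (\sum_(m <- msupp p) p@_m *: 'X_[m - U_(s)]).
rewrite {1}[p]mpolyE mulr_sumr !big_seq; apply: eq_bigr => m mp.
rewrite -scalerAr -mpolyXD addmC submK // lep1mP; apply: contraTN mp => /eqP m0.
by rewrite -mcoeff_eq0 (monP m) m0 p0.
Qed.

Lemma sum_msupp_single p m0 (F : 'X_{1..2} -> K) :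
  (forall m, m != m0 -> F m = 0) ->
  \sum_(m <- msupp p) p@_m * F m = p@_m0 * F m0.
Proof.
move=> F0; have [mp|mp] := boolP (m0 \in msupp p).
  rewrite (bigD1_seq m0) ?msupp_uniq //= big1 ?addr0 // => m /F0 ->.
  by rewrite mulr0.
rewrite (memN_msupp_eq0 mp) mul0r big_seq big1 // => m mp'.
by rewrite F0 ?mulr0 //; apply: contraNneq mp => <-.
Qed.

End Monomials.

(** * Coordinates modulo the ideal *)

Section Coordinates.
Variables (K : fieldType) (o s : 'I_2) (t : K).
Hypothesis os : o != s.
Local Notation P := (superpoly K).
Implicit Types f g p : P.
Local Notation mon := (mon o s).
Local Notation "p @[ k , j ]" := (p@_(mon k j)) (at level 2, format "p @[ k ,  j ]").

(** The coordinates of a class modulo the ideal generated by [gens].  The one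
along z_o^k z_s absorbs the z3 z4 component, which is - 2 t z_o z_s there. *)
Definition coordA k f := (sp0 f)@[k, 0].
Definition coordB k f := (sp0 f - (2 * t) *: ('X_o * ('X_s * sp34 f)))@[k, 1].
Definition coordC k f := (sp3 f)@[k, 0].
Definition coordD k f := (sp4 f)@[k, 0].

Definition vanishing f := forall k,
  [/\ coordA k f = 0, coordB k f = 0, coordC k f = 0 & coordD k f = 0].

Lemma coordBE k f :
  coordB k f = (sp0 f)@[k, 1] - 2 * t * ('X_o * sp34 f)@[k, 0].
Proof. by rewrite /coordB mcoeffB mcoeffZ mulrCA mcoeff_Xs. Qed.

Lemma coordBB k f g : coordB k (f - g) = coordB k f - coordB k g.
Proof.
rewrite !coordBE /= mulrBr !mcoeffB; ring.
Qed.

Definition zvar i : P := SuperPoly 'X_i 0 0 0.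

Lemma zvarC i j : zvar i * zvar j = zvar j * zvar i.
Proof. by apply: superpoly_eq => /=; ring. Qed.

Definition gens : seq P :=
  [:: (2 * t) *: (zvar o * zvar s) + z3 * z4;
      zvar s ^+ 2; zvar s * z3; zvar s * z4].

(** An explicit description of the ideal: it is visibly closed under the
operations of an ideal, and visibly spanned by multiples of the generators. *)
Definition in_normal f := exists x y w,
  [/\ sp3 f = 'X_s * x, sp4 f = 'X_s * y &
      sp0 f = 'X_s ^+ 2 * w + (2 * t)%:MP * ('X_o * 'X_s * sp34 f)].

(** When the coordinates vanish, the odd components are divisible by z_s.  The
even component left after eliminating z3 z4 is divisible by z_s twice, since
its coefficients along z_o^k and z_o^k z_s are a_k and b_k. *)
Lemma vanishing_normal f : vanishing f -> in_normal f.
Proof.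
move=> vf.
have [x ex] : exists q, sp3 f = 'X_s * q.
  by apply: (dvd_Xs os) => k; case: (vf k).
have [y ey] : exists q, sp4 f = 'X_s * q.
  by apply: (dvd_Xs os) => k; case: (vf k).
pose h := sp0 f - (2 * t) *: ('X_o * ('X_s * sp34 f)).
have [v ev] : exists q, h = 'X_s * q.
  apply: (dvd_Xs os) => k; have [ak _ _ _] := vf k.
  by rewrite mcoeffB mcoeffZ mulrCA (mcoeff_Xs0 os) mulr0 subr0.
have [w ew] : exists q, v = 'X_s * q.
  by apply: (dvd_Xs os) => k; have [_ <- _ _] := vf k; rewrite /coordB -/h ev mcoeff_Xs.
exists x, y, w; split=> //; rewrite expr2 -[_ * _ * w]mulrA -ew -ev /h.
by rewrite -mul_mpolyC mulrA subrK.
Qed.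

Lemma normal_vanishing f : in_normal f -> vanishing f.
Proof.
move=> [x [y [w [e3 e4 e0]]]] k; split.
- rewrite /coordA e0 mcoeffD mcoeffCM expr2 -mulrA -mulrA [_ * (_ * sp34 f)]mulrCA.
  by rewrite !(mcoeff_Xs0 os) mulr0 addr0.
- rewrite /coordB e0 -mul_mpolyC -['X_o * _ * _]mulrA addrK expr2 -mulrA.
  by rewrite mcoeff_Xs (mcoeff_Xs0 os).
- by rewrite /coordC e3 (mcoeff_Xs0 os).
- by rewrite /coordD e4 (mcoeff_Xs0 os).
Qed.

Lemma in_normal_ideal : two_sided_ideal in_normal.
Proof.
split.
- by exists 0, 0, 0; split=> /=; rewrite !mulr0 ?addr0.
- move=> f g [x [y [w [f3 f4 f0]]]] [x' [y' [w' [g3 g4 g0]]]].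
  exists (x + x'), (y + y'), (w + w').
  by split=> /=; rewrite ?f3 ?f4 ?f0 ?g3 ?g4 ?g0; ring.
- (* The even component of f is itself a multiple z_s r, which supplies the
     second factor z_s wherever z_o z_s multiplies a product. *)
  move=> u f v [x [y [w [f3 f4 f0]]]].
  pose r := 'X_s * w + (2 * t)%:MP * ('X_o * sp34 f) : {mpoly K[2]}.
  have f0r : sp0 f = 'X_s * r by rewrite f0 /r; ring.
  exists (sp0 u * r * sp3 v + (sp0 u * x + sp3 u * r) * sp0 v),
         (sp0 u * r * sp4 v + (sp0 u * y + sp4 u * r) * sp0 v).
  exists (w * sp0 u * sp0 v - (2 * t)%:MP * 'X_o *
    (sp0 u * r * sp34 v + (sp34 u * r + sp3 u * y - sp4 u * x) * sp0 v
     + (sp0 u * x + sp3 u * r) * sp4 v - (sp0 u * y + sp4 u * r) * sp3 v)).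
  split=> /=; rewrite ?f3 ?f4 ?f0r; try by ring.
  rewrite /r; ring.
Qed.

(** The coordinates are well defined on the quotient and determine the class:
the set cut out by their vanishing is an ideal containing the generators, and
the normal form writes each of its elements in terms of them. *)
Lemma ideal_gen_vanishing f : reflect (vanishing f) (f \in ideal_gen gens).
Proof.
apply: (iffP idP) => [/asboolP fI|/vanishing_normal[x [y [w [e3 e4 e0]]]]].
  apply: normal_vanishing; apply: fI; first exact: in_normal_ideal.
  move=> g; rewrite !inE => /or4P[] /eqP ->.
  - by exists 0, 0, 0; split=> /=; rewrite ?scaler0 -?mul_mpolyC; ring.
  - by exists 0, 0, 1; split=> /=; ring.
  - by exists 1, 0, 0; split=> /=; ring.
  - by exists 0, 1, 0; split=> /=; ring.
have -> : f = (SuperPoly w 0 0 0) * zvar s ^+ 2 * 1 + 1 * (zvar s * z3) * (SuperPoly x 0 0 0)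
  + 1 * (zvar s * z4) * (SuperPoly y 0 0 0)
  + (SuperPoly (sp34 f) 0 0 0) * ((2 * t) *: (zvar o * zvar s) + z3 * z4) * 1.
  apply: superpoly_eq => /=; rewrite ?e0 ?e3 ?e4 ?scaler0 -?mul_mpolyC; ring.
apply/asboolP => J [_ JD JM] Jg.
apply: (JD); [apply: (JD); [apply: (JD)|]|]; apply: JM; apply: Jg; rewrite !inE; apply/or4P.
- exact: Or42.
- exact: Or43.
- exact: Or44.
- exact: Or41.
Qed.

End Coordinates.

(** * Action of the Bessel operators on the coordinates *)

Section Operators.
Variables (K : fieldType) (o s : 'I_2) (t mu : K).
Hypothesis os : o != s.
Implicit Types f g p : superpoly K.
Local Notation mon := (mon o s).
Local Notation coA := (coordA o s).
Local Notation coB := (coordB o s t).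
Local Notation coC := (coordC o s).
Local Notation coD := (coordD o s).

(** The even Bessel operator attached to z_i.  The odd Euler operator
z3 d3 + z4 d4 takes the values 0, 1, 1, 2 on the four components, and the term
in d3 d4 contributes only to the even component, with d3 d4 (z3 z4) = -1. *)
Definition bessel_even (i j : 'I_2) (m c : K) f : superpoly K :=
  let shift k (h : {mpoly K[2]}) := (k%:R - m) *: h^`M(i) + 'X_i * h^`M(i)^`M(i) in
  SuperPoly (shift 0%N (sp0 f) + c *: ('X_j * sp34 f))
            (shift 1%N (sp3 f)) (shift 1%N (sp4 f)) (shift 2%N (sp34 f)).

(** At the two special values of lambda the operators of the long and short
variables differ only by their parameters: the short one has parameter 1. *)
Definition bessel_long := bessel_even o s mu (2 * t * mu).
Definition bessel_short := bessel_even s o 1 (2 * t).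

(** The part of the odd operators that differentiates only in the even
variables.  The terms in z3 d3 and z4 d4 act only on the component along z3 z4,
where they add the constant 2 t (1 + mu). *)
Definition bessel_euler (h : {mpoly K[2]}) :=
  (2 * t) *: ('X_o * h^`M(o) + mu *: ('X_s * h^`M(s)) - mu *: h).

Definition bessel_odd3 f : superpoly K :=
  SuperPoly (bessel_euler (sp4 f))
    ((sp0 f)^`M(o)^`M(s) - bessel_euler (sp34 f) - (2 * t * (1 + mu)) *: sp34 f)
    0 ((sp4 f)^`M(o)^`M(s)).

Definition bessel_odd4 f : superpoly K :=
  SuperPoly (- bessel_euler (sp3 f)) 0
    ((sp0 f)^`M(o)^`M(s) - bessel_euler (sp34 f) - (2 * t * (1 + mu)) *: sp34 f)
    (- (sp3 f)^`M(o)^`M(s)).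

Local Notation coE := (mcoeffD, mcoeffB, mcoeffN, mcoeffZ, mcoeff0, mcoeff_euler_o os,
  mcoeff_euler_s os, mcoeff_deriv_o os, mcoeff_deriv_s os).

Lemma coA_long k f :
  coA k (bessel_long f) = k.+1%:R * (k%:R - mu) * coA k.+1 f.
Proof. rewrite /coordA /= !coE (mcoeff_Xs0 os); ring. Qed.

(** The z3 z4 component contributes 2 t mu - 2 t k (k + 1 - mu), which factors as
- 2 t (k + 1) (k - mu).  It therefore scales like the z_o^k z_s coefficient. *)
Lemma coB_long k f :
  coB k (bessel_long f) = k.+1%:R * (k%:R - mu) * coB k.+1 f.
Proof.
rewrite !coordBE //= !coE mcoeff_Xs mcoeff_Xo.
case: k => [|k]; rewrite ?mcoeff_Xo0 // ?mcoeff_Xo ?coE; ring.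
Qed.

Lemma coA_short k f : coA k (bessel_short f) = - coB k f.
Proof. rewrite coordBE // /coordA /= !coE; ring. Qed.

Lemma coB_short k f : coB k (bessel_short f) = 0.
Proof.
rewrite coordBE //= !coE.
case: k => [|k]; rewrite ?mcoeff_Xo0 // ?mcoeff_Xo ?coE; ring.
Qed.

Lemma coA_odd3 k f : coA k (bessel_odd3 f) = 2 * t * (k%:R - mu) * coD k f.
Proof. rewrite /coordA /coordD /= !coE; ring. Qed.

Lemma coB_odd3 k f : coB k (bessel_odd3 f) = 0.
Proof.
rewrite coordBE //= !coE.
case: k => [|k]; rewrite ?mcoeff_Xo0 // ?mcoeff_Xo ?coE; ring.
Qed.

Lemma coA_odd4 k f : coA k (bessel_odd4 f) = - (2 * t * (k%:R - mu)) * coC k f.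
Proof. rewrite /coordA /coordC /= !coE; ring. Qed.

Lemma coB_odd4 k f : coB k (bessel_odd4 f) = 0.
Proof.
rewrite coordBE //= !coE.
case: k => [|k]; rewrite ?mcoeff_Xo0 // ?mcoeff_Xo ?coE; ring.
Qed.

Lemma coD_odd4 k f : coD k (bessel_odd4 f) = k.+1%:R * coB k.+1 f.
Proof. rewrite coordBE // /coordD /= !coE mcoeff_Xo; ring. Qed.

(** The factor picked up by a_0 when it crosses the k-th power of the long
operator.  Where it vanishes, z_o^k pairs to zero with everything. *)
Definition weight k : K := \prod_(j < k) (j.+1%:R * (j%:R - mu)).

(** The value at 0 of the word B_o^(m o) B_s^(m s) applied to f: the short
operator turns a into - b and then kills it, so m s > 1 gives 0. *)
Definition word_value (m : 'X_{1..2}) f : K :=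
  weight (m o) *
    (if m s == 0%N then coA (m o) f else if m s == 1%N then - coB (m o) f else 0).

Lemma coA_long_iter n k f :
  weight k * coA k (iter n bessel_long f) = weight (k + n) * coA (k + n) f.
Proof.
elim: n k => [|n IH] k; first by rewrite addn0.
rewrite iterS coA_long mulrA addnS -addSn -IH; congr (_ * _).
by rewrite /weight big_ord_recr.
Qed.

Lemma coB_long_iter n k f :
  weight k * coB k (iter n bessel_long f) = weight (k + n) * coB (k + n) f.
Proof.
elim: n k => [|n IH] k; first by rewrite addn0.
rewrite iterS coB_long mulrA addnS -addSn -IH; congr (_ * _).
by rewrite /weight big_ord_recr.
Qed.

Lemma coA_short_iter j k f : coA k (iter j bessel_short f) =
  if j == 0%N then coA k f else if j == 1%N then - coB k f else 0.
Proof. by case: j => [|[|j]] //=; rewrite coA_short ?coB_short ?oppr0. Qed.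

Lemma weight0 : weight 0 = 1.
Proof. exact: big_ord0. Qed.

(** The words B_o^i B_s^j and B_s^j B_o^i take the same value at 0, because the
long operator scales a_k and b_k by the same factor.  Both orders are needed:
z1 is the long variable in one case and the short one in the other. *)
Lemma long_short_word (m : 'X_{1..2}) f :
  coA 0 (iter (m o) bessel_long (iter (m s) bessel_short f)) = word_value m f.
Proof.
by rewrite -[LHS]mul1r -weight0 coA_long_iter add0n coA_short_iter.
Qed.

Lemma short_long_word (m : 'X_{1..2}) f :
  coA 0 (iter (m s) bessel_short (iter (m o) bessel_long f)) = word_value m f.
Proof.
rewrite coA_short_iter /word_value -[LHS]mul1r -weight0.
case: eqP => _; first by rewrite coA_long_iter.
case: eqP => _; last by rewrite !mulr0.
by rewrite !mulrN coB_long_iter.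
Qed.

Definition even_pairing (p : {mpoly K[2]}) f : K :=
  \sum_(m <- msupp p) p@_m * word_value m f.

Definition bessel_pairing p f : K :=
  even_pairing (sp0 p) f + even_pairing (sp3 p) (bessel_odd3 f)
  + even_pairing (sp4 p) (bessel_odd4 f)
  + even_pairing (sp34 p) (bessel_odd3 (bessel_odd4 f)).

Lemma word_value_odd3 (m : 'X_{1..2}) f : word_value m (bessel_odd3 f) =
  if m s == 0%N then weight (m o) * (2 * t * ((m o)%:R - mu)) * coD (m o) f else 0.
Proof.
rewrite /word_value coA_odd3 coB_odd3 oppr0 if_same.
by case: eqP; rewrite ?mulr0 // mulrA.
Qed.

Lemma word_value_odd4 (m : 'X_{1..2}) f : word_value m (bessel_odd4 f) =
  if m s == 0%N then - weight (m o) * (2 * t * ((m o)%:R - mu)) * coC (m o) f else 0.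
Proof.
rewrite /word_value coA_odd4 coB_odd4 oppr0 if_same.
by case: eqP; rewrite ?mulr0 // !mulNr mulrN mulrA.
Qed.

(** The factor (k + 1) (k - mu) produced by the two odd operators is the one
that turns the weight at k into the weight at k + 1, so this word belongs to
the b-coordinate at k + 1, in accordance with z3 z4 = - 2 t z_o z_s. *)
Lemma word_value_odd34 (m : 'X_{1..2}) f : word_value m (bessel_odd3 (bessel_odd4 f)) =
  if m s == 0%N then 2 * t * weight (m o).+1 * coB (m o).+1 f else 0.
Proof.
rewrite word_value_odd3 coD_odd4 {2}/weight big_ord_recr /= -/(weight _).
by case: eqP => // _; ring.
Qed.

(** Reduces the value at 0 of p applied to its operators to the values of the
words in the two even ones, whatever the order in which these are composed. *)
Lemma pairing_subst (D1 D2 : superpoly K -> superpoly K) p f :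
  (forall (m : 'X_{1..2}) g, coA 0 (iter (m 0) D1 (iter (m 1) D2 g)) = word_value m g) ->
  sp_eval0 (super_subst D1 D2 bessel_odd3 bessel_odd4 p f) = bessel_pairing p f.
Proof.
move=> D12; have evE (q : {mpoly K[2]}) g :
    sp_eval0 (even_subst D1 D2 q g) = even_pairing q g.
  rewrite /even_pairing -(eq_bigr _ (fun m _ => congr1 _ (D12 m g))).
  rewrite /even_subst /sp_eval0; elim/big_rec2: _ => [|m x y _ <-] /=.
    by rewrite mcoeff0.
  by rewrite mcoeffD mcoeffZ /coordA mon00.
by rewrite /bessel_pairing -!evE /sp_eval0 /= !mcoeffD.
Qed.

End Operators.

(** * The pairing in coordinates *)

Section Nondegeneracy.
Variables (K : fieldType) (o s : 'I_2) (t mu : K).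
Hypothesis os : o != s.
Implicit Types f g p : superpoly K.
Local Notation mon := (mon o s).
Local Notation coA := (coordA o s).
Local Notation coB := (coordB o s t).
Local Notation coC := (coordC o s).
Local Notation coD := (coordD o s).
Local Notation weight := (weight mu).
Local Notation pairing := (bessel_pairing o s t mu).

(** Only the exponents on one line contribute, which turns a sum over the support
into a sum over the exponent of the long variable. *)
Lemma sum_msupp_line (p : {mpoly K[2]}) j N (G : nat -> K) : (msize p <= N)%N ->
  \sum_(m <- msupp p) p@_m * (if m s == j then G (m o) else 0) =
  \sum_(k < N) p@_(mon k j) * G k.
Proof.
move=> pN; transitivity (\sum_(k < N) \sum_(m <- msupp p)
    p@_m * (if m == mon k j then G k else 0)).
  rewrite exchange_big /= !big_seq; apply: eq_bigr => m mp.
  have mN : (m o < N)%N.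
    apply: leq_trans (leq_trans (msize_mdeg_lt mp) pN).
    by rewrite ltnS mdegE (bigD1 o) //= leq_addr.
  rewrite -mulr_sumr; congr (_ * _); rewrite (bigD1 (Ordinal mN)) //= big1 => [|k km].
    by rewrite addr0 {3}(monP os m) (mon_inj os) eqxx.
  rewrite {1}(monP os m) (mon_inj os); case: eqP => // mk.
  by case/eqP: km; apply: val_inj.
apply: eq_bigr => k _; rewrite (@sum_msupp_single _ _ (mon k j)) ?eqxx // => m.
by move/negbTE ->.
Qed.

(** All coefficients of p vanish from this degree on, which is what makes the
sum over k in [pairingE] finite. *)
Definition pairing_bound p :=
  maxn (maxn (msize (sp0 p)) (msize (sp3 p))) (maxn (msize (sp4 p)) (msize (sp34 p))).

(** The Bessel-Fischer product is block diagonal in the coordinates.  The even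
component of p pairs through a and b, the components along z3 and z4 through
d and c, and the one along z3 z4 completes the coefficient of p along z_o^k z_s
to b_k p. *)
Lemma pairingE N p f : (pairing_bound p <= N)%N ->
  pairing p f = \sum_(k < N.+1) weight k *
    (coA k p * coA k f - coB k p * coB k f
     + 2 * t * (k%:R - mu) * (coC k p * coD k f - coD k p * coC k f)).
Proof.
rewrite /pairing_bound !geq_max => /andP[/andP[s0 s3] /andP[s4 s34]].
have e0 : even_pairing o s t mu (sp0 p) f = \sum_(k < N.+1) weight k *
    (coA k p * coA k f - (sp0 p)@_(mon k 1) * coB k f).
  pose FA k := weight k * coA k f; pose FB k := - (weight k * coB k f).
  transitivity (\sum_(m <- msupp (sp0 p)) (sp0 p)@_m * (if m s == 0%N then FA (m o) else 0)
     + \sum_(m <- msupp (sp0 p)) (sp0 p)@_m * (if m s == 1%N then FB (m o) else 0)).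
    rewrite -big_split; apply: eq_bigr => m _ /=; rewrite -mulrDr; congr (_ * _).
    rewrite /word_value; case: eqP => [-> /=|_]; first by rewrite addr0.
    by case: eqP => _; rewrite ?mulr0 add0r // mulrN.
  rewrite !(@sum_msupp_line _ _ N.+1) ?leqW // -big_split; apply: eq_bigr => k _ /=.
  by rewrite /FA /FB /coordA; ring.
have e3 : even_pairing o s t mu (sp3 p) (bessel_odd3 o s t mu f) = \sum_(k < N.+1)
    weight k * (2 * t * (k%:R - mu) * (coC k p * coD k f)).
  pose F k := weight k * (2 * t * (k%:R - mu)) * coD k f.
  rewrite /even_pairing; under eq_bigr do rewrite word_value_odd3 // -/(F _).
  rewrite (@sum_msupp_line _ _ N.+1) ?leqW //; apply: eq_bigr => k _.
  by rewrite /F /coordC; ring.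
have e4 : even_pairing o s t mu (sp4 p) (bessel_odd4 o s t mu f) = \sum_(k < N.+1)
    weight k * (2 * t * (k%:R - mu) * - (coD k p * coC k f)).
  pose F k := - weight k * (2 * t * (k%:R - mu)) * coC k f.
  rewrite /even_pairing; under eq_bigr do rewrite word_value_odd4 // -/(F _).
  rewrite (@sum_msupp_line _ _ N.+1) ?leqW //; apply: eq_bigr => k _.
  by rewrite /F {1}/coordD; ring.
have e34 : even_pairing o s t mu (sp34 p) (bessel_odd3 o s t mu (bessel_odd4 o s t mu f)) =
    \sum_(k < N.+1) weight k * (2 * t * ('X_o * sp34 p)@_(mon k 0) * coB k f).
  pose F k := 2 * t * weight k.+1 * coB k.+1 f.
  rewrite /even_pairing; under eq_bigr do rewrite word_value_odd34 // -/(F _).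
  (* The term at k of the line of exponents becomes the term at k + 1: the shift
     is multiplication by z_o, and its term at 0 is zero. *)
  rewrite (@sum_msupp_line _ _ N) // big_ord_recl /= (mcoeff_Xo0 os).
  rewrite mulr0 mul0r mulr0 add0r; apply: eq_bigr => k _.
  by rewrite mcoeff_Xo /F; ring.
rewrite /bessel_pairing e0 e3 e4 e34 -!big_split; apply: eq_bigr => k _ /=.
rewrite [coB k p]coordBE //; ring.
Qed.

Definition same_coords f g := forall k,
  [/\ coA k f = coA k g, coB k f = coB k g,
      coC k f = coC k g & coD k f = coD k g].

Lemma pairing_congr p f g : same_coords f g -> pairing p f = pairing p g.
Proof.
move=> fg; rewrite !(pairingE _ (leqnn (pairing_bound p))); apply: eq_bigr => k _.
by case: (fg k) => -> -> -> ->.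
Qed.

(** Monomials with a single nonzero coordinate, which form a basis of the
quotient. *)
Definition testA n : superpoly K := SuperPoly 'X_[mon n 0] 0 0 0.
Definition testB n : superpoly K := SuperPoly 'X_[mon n 1] 0 0 0.
Definition testC n : superpoly K := SuperPoly 0 'X_[mon n 0] 0 0.
Definition testD n : superpoly K := SuperPoly 0 0 'X_[mon n 0] 0.

Lemma coord_testA n k : [/\ coA k (testA n) = (n == k)%:R,
  coB k (testA n) = 0, coC k (testA n) = 0 & coD k (testA n) = 0].
Proof.
rewrite coordBE // /coordA /coordC /coordD /= !mulr0 !mcoeff0 !mcoeffX !mon_inj //=.
by rewrite andbT andbF mulr0 subr0.
Qed.

Lemma coord_testB n k : [/\ coA k (testB n) = 0,
  coB k (testB n) = (n == k)%:R, coC k (testB n) = 0 & coD k (testB n) = 0].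
Proof.
rewrite coordBE // /coordA /coordC /coordD /= !mulr0 !mcoeff0 !mcoeffX !mon_inj //=.
by rewrite andbT andbF mulr0 subr0.
Qed.

Lemma coord_testC n k : [/\ coA k (testC n) = 0,
  coB k (testC n) = 0, coC k (testC n) = (n == k)%:R & coD k (testC n) = 0].
Proof.
rewrite coordBE // /coordA /coordC /coordD /= !mulr0 !mcoeff0 !mcoeffX !mon_inj //=.
by rewrite andbT mulr0 subr0.
Qed.

Lemma coord_testD n k : [/\ coA k (testD n) = 0,
  coB k (testD n) = 0, coC k (testD n) = 0 & coD k (testD n) = (n == k)%:R].
Proof.
rewrite coordBE // /coordA /coordC /coordD /= !mulr0 !mcoeff0 !mcoeffX !mon_inj //=.
by rewrite andbT mulr0 subr0.
Qed.

Lemma sum_delta n N (F : nat -> K) : (n <= N)%N ->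
  \sum_(k < N.+1) F k * (n == k)%:R = F n.
Proof.
rewrite -ltnS => nN; rewrite (bigD1 (Ordinal nN)) //= eqxx mulr1 big1 ?addr0 // => k kn.
case: eqP => [nk|_]; last by rewrite mulr0.
by case/eqP: kn; apply: val_inj.
Qed.

Hypotheses (t0 : t != 0) (mu_nat : forall k, mu != k%:R)
  (char0 : forall k, k.+1%:R != 0 :> K).

Lemma weight_neq0 k : weight k != 0.
Proof.
by apply/prodf_neq0 => j _; rewrite mulf_neq0 ?char0 // subr_eq0 eq_sym mu_nat.
Qed.

(** Each test monomial isolates one coordinate of p, multiplied by a nonzero
factor; c and d are exchanged by the pairing. *)
Lemma pairing_nondegenerate p :
  (forall n, [/\ pairing p (testA n) = 0, pairing p (testB n) = 0,
                 pairing p (testC n) = 0 & pairing p (testD n) = 0]) ->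
  vanishing o s t p.
Proof.
move=> p0 n; pose N := maxn n (pairing_bound p).
have nN : (n <= N)%N by rewrite leq_maxl.
have pN : (pairing_bound p <= N)%N by rewrite leq_maxr.
have w0 := weight_neq0.
have c0 k : weight k * (2 * t * (k%:R - mu)) != 0.
  by rewrite !mulf_neq0 ?w0 ?(char0 1) // subr_eq0 eq_sym mu_nat.
case: (p0 n); rewrite !(pairingE _ pN) => pA pB pC pD; split.
- apply: (mulfI (w0 n)); rewrite mulr0 -pA -(sum_delta (fun k => weight k * coA k p) nN).
  by apply: eq_bigr => k _; case: (coord_testA n k) => -> -> -> ->; ring.
- apply: (mulfI (w0 n)); rewrite mulr0 -[RHS]oppr0 -pB.
  rewrite -(sum_delta (fun k => weight k * coB k p) nN).
  by rewrite -sumrN; apply: eq_bigr => k _; case: (coord_testB n k) => -> -> -> ->; ring.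
- apply: (mulfI (c0 n)); rewrite mulr0 -pD.
  rewrite -(sum_delta (fun k => weight k * (2 * t * (k%:R - mu)) * coC k p) nN).
  by apply: eq_bigr => k _; case: (coord_testD n k) => -> -> -> ->; ring.
- apply: (mulfI (c0 n)); rewrite mulr0 -[RHS]oppr0 -pC.
  rewrite -(sum_delta (fun k => weight k * (2 * t * (k%:R - mu)) * coD k p) nN).
  by rewrite -sumrN; apply: eq_bigr => k _; case: (coord_testC n k) => -> -> -> ->; ring.
Qed.

End Nondegeneracy.

(** * The Bessel operators at the two parameters *)

Section BesselOperators.
Variables (K : fieldType) (a l : K).
Implicit Types f : superpoly K.

Lemma bessel1E : bessel1 a l = bessel_even 0 1 l (2 * a).
Proof.
apply/funext => f; apply: superpoly_eq => /=;
  rewrite ?mderivN -?mul_mpolyC; ring.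
Qed.

Lemma bessel2E : bessel2 a l = bessel_even 1 0 (l / a) 2.
Proof.
apply/funext => f; apply: superpoly_eq => /=;
  rewrite ?mderivN -?mul_mpolyC; ring.
Qed.

End BesselOperators.

Section OddBesselOperators.
Variables (K : fieldType) (a : K).

Lemma bessel3_alpha : bessel3 a a = bessel_odd3 0 1 1 a.
Proof.
apply/funext => f; apply: superpoly_eq => /=; rewrite /bessel_euler
  ?mderivN ?mderiv0 ?[_^`M(1)^`M(0)]mderiv_comm -?mul_mpolyC; ring.
Qed.

Lemma bessel4_alpha : bessel4 a a = bessel_odd4 0 1 1 a.
Proof.
apply/funext => f; apply: superpoly_eq => /=; rewrite /bessel_euler
  ?mderivN ?mderiv0 ?[_^`M(1)^`M(0)]mderiv_comm -?mul_mpolyC; ring.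
Qed.

Hypothesis a0 : a != 0.
Let aV : a%:MP * a^-1%:MP = 1 :> {mpoly K[2]}.
Proof. by rewrite -mpolyCM divff. Qed.

(** Exchanging z1 and z2 replaces alpha by 1 / alpha.  The coefficients of z1 d1
and z2 d2 in the odd operators are then in the right ratio, and the factor t = alpha
restores their size. *)
Lemma bessel3_one : bessel3 a 1 = bessel_odd3 1 0 a a^-1.
Proof.
apply/funext => f; apply: superpoly_eq => /=; rewrite /bessel_euler
  ?mderivN ?mderiv0 -?mul_mpolyC; ring: aV.
Qed.

Lemma bessel4_one : bessel4 a 1 = bessel_odd4 1 0 a a^-1.
Proof.
apply/funext => f; apply: superpoly_eq => /=; rewrite /bessel_euler
  ?mderivN ?mderiv0 -?mul_mpolyC; ring: aV.
Qed.

Lemma bessel_subst_one p f : sp_eval0 (bessel_subst a 1 p f) =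
  bessel_pairing 1 0 a a^-1 p f.
Proof.
rewrite /bessel_subst bessel3_one bessel4_one; apply: pairing_subst => // m g.
have -> : bessel2 a 1 = bessel_long 1 0 a a^-1.
  by rewrite bessel2E /bessel_long -mulrA divff // mulr1 div1r.
have -> : bessel1 a 1 = bessel_short 1 0 a by exact: bessel1E.
exact: short_long_word.
Qed.

Lemma bessel_subst_alpha p f : sp_eval0 (bessel_subst a a p f) =
  bessel_pairing 0 1 1 a p f.
Proof.
rewrite /bessel_subst bessel3_alpha bessel4_alpha; apply: pairing_subst => // m g.
have -> : bessel1 a a = bessel_long 0 1 1 a.
  by rewrite bessel1E /bessel_long mulr1.
have -> : bessel2 a a = bessel_short 0 1 1.
  by rewrite bessel2E /bessel_short mulr1 divff.
exact: long_short_word.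
Qed.

End OddBesselOperators.

(** * The Fock space *)

Section Fock.
Local Open Scope quotient_scope.
Variables (R : realType) (alpha lambda : R) (o s : 'I_2) (t mu : R[i]).
Hypothesis os : o != s.
Local Notation P := (superpoly R[i]).

Lemma sp_conj_tests n : [/\ sp_conj (testA R[i] o s n) = testA R[i] o s n,
  sp_conj (testB R[i] o s n) = testB R[i] o s n,
  sp_conj (testC R[i] o s n) = testC R[i] o s n &
  sp_conj (testD R[i] o s n) = testD R[i] o s n].
Proof. by split; apply: superpoly_eq; rewrite /= ?map_mpolyX ?rmorph0. Qed.

(** Conjugation of the coefficients preserves the ideal because t is real. *)
Lemma same_coords_conj (f g : P) : conjc t = t ->
  vanishing o s t (f - g) -> same_coords o s t (sp_conj f) (sp_conj g).
Proof.
move=> tC fg k; have [eA eB eC eD] := fg k.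
have cB (h : P) : coordB o s t k (sp_conj h) = conjc (coordB o s t k h).
  have XoC : ('X_o * map_mpoly (@conjc R) (sp34 h))@_(mon o s k 0) =
      conjc ('X_o * sp34 h)@_(mon o s k 0).
    by case: (k) => [|k']; rewrite ?(mcoeff_Xo0 os) ?conjc0 // !mcoeff_Xo mcoeff_map_mpoly.
  rewrite !coordBE //= XoC mcoeff_map_mpoly rmorphB; congr (_ - _).
  by rewrite rmorphM; congr (_ * _); rewrite rmorphM rmorph_nat; congr (_ * _); exact: esym tC.
have mC (u : {mpoly R[i][2]}) m : (map_mpoly (@conjc R) u)@_m = conjc u@_m.
  exact: mcoeff_map_mpoly.
have eqC m (u v : {mpoly R[i][2]}) : (u - v)@_m = 0 ->
    (map_mpoly (@conjc R) u)@_m = (map_mpoly (@conjc R) v)@_m.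
  by move=> uv; apply: etrans (mC u m) (etrans _ (esym (mC v m)));
    rewrite -[u](subrK v) mcoeffD uv add0r.
split.
- exact: (eqC _ _ _ eA).
- have eqB : coordB o s t k f = coordB o s t k g.
    by apply: subr0_eq; rewrite -eB coordBB.
  exact: etrans (cB f) (etrans (congr1 (@conjc R) eqB) (esym (cB g))).
- exact: (eqC _ _ _ eC).
- exact: (eqC _ _ _ eD).
Qed.

(** The product on the quotient is computed on chosen representatives.  For the
second argument this is harmless, as the pairing sees only coordinates; the
first one is tested directly on its representative. *)
Lemma fock_nondegenerate : conjc t = t -> t != 0 ->
  (forall k, mu != k%:R) ->
  (forall f, (f \in fock_ideal alpha lambda) = (f \in ideal_gen (gens o s t))) ->
  (forall p f, sp_eval0 (bessel_subst alpha%:C%C lambda%:C%C p f) =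
     bessel_pairing o s t mu p f) ->
  forall p : fock alpha lambda,
    (forall q : fock alpha lambda, fock_bessel_fischer p q = 0) -> p = 0.
Proof.
move=> tC t0 mu_nat idealE pairE p p0.
have test (g : P) : bessel_pairing o s t mu (repr p) (sp_conj g) = 0.
  pose q : fock alpha lambda := \pi_(fock alpha lambda) g.
  have gI : g - repr q \in fock_ideal alpha lambda.
    rewrite Quotient.idealrBE; apply/eqP.
    exact: (esym (@reprK _ (fock alpha lambda) q)).
  have gq : same_coords o s t (sp_conj g) (sp_conj (repr q)).
    apply: (same_coords_conj tC); apply/(ideal_gen_vanishing _ os).
    by rewrite -idealE.
  rewrite (pairing_congr mu os (repr p) gq) -(p0 q).
  by rewrite /fock_bessel_fischer -lock /bessel_fischer pairE.
have vp : vanishing o s t (repr p).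
  apply: (pairing_nondegenerate os t0 mu_nat) => [k|n]; first by rewrite pnatr_eq0.
  have [<- <- <- <-] := sp_conj_tests n.
  split; exact: test.
have pI : repr p - 0 \in fock_ideal alpha lambda.
  by rewrite subr0 idealE; apply/(ideal_gen_vanishing _ os).
rewrite Quotient.idealrBE in pI; rewrite -[LHS]reprK (eqP pI).
by rewrite [0 in RHS]/GRing.zero /= /Quotient.zero -lock.
Qed.

End Fock.

Section TwoFamilies.
Variables (R : realType) (alpha : R).
Local Notation P := (superpoly R[i]).

Lemma fock_ideal_alpha (f : P) :
  (f \in fock_ideal alpha alpha) = (f \in ideal_gen (gens 0 1 (1 : R[i]))).
Proof. by rewrite /fock_ideal /= /fock_gens eqxx /gens mulr1. Qed.

Lemma fock_ideal_one (f : P) : alpha != 1 ->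
  (f \in fock_ideal alpha 1) = (f \in ideal_gen (gens 1 0 alpha%:C%C)).
Proof.
move=> a1; rewrite /fock_ideal /= /fock_gens eq_sym (negbTE a1) eqxx /gens.
by rewrite zvarC.
Qed.

End TwoFamilies.

Theorem corollary5p8 (R : realType) (alpha lambda : R) :
  alpha != 0 -> alpha != 1 ->
  (lambda = alpha /\ alpha \isn't a Num.nat) \/
  (lambda = 1 /\ alpha^-1 \isn't a Num.nat) ->
  forall p : fock alpha lambda,
    (forall q : fock alpha lambda, fock_bessel_fischer p q = 0) -> p = 0.
Proof.
move=> a0 a1; have a0C : alpha%:C%C != 0 :> R[i] by rewrite fmorph_eq0.
have natC (x : R) : x \isn't a Num.nat -> forall k, x%:C%C != k%:R.
  move=> xN k; apply: contraNneq xN => /(congr1 (@complex.Re R)).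
  by rewrite -(rmorph_nat (real_complex R)) /= => ->; apply: natr_nat.
case=> -[-> nat].
- exact: (fock_nondegenerate (isT : 0 != 1 :> 'I_2) (conjc1 R) (oner_neq0 _)
    (natC _ nat) (@fock_ideal_alpha R alpha) (bessel_subst_alpha a0C)).
- apply: (fock_nondegenerate (isT : 1 != 0 :> 'I_2) (conjc_real alpha) a0C
    (mu := (alpha%:C%C)^-1) _ (fun f => fock_ideal_one f a1)).
    by move=> k; rewrite -(fmorphV (real_complex R)); apply: natC.
  by move=> p f; rewrite rmorph1; apply: bessel_subst_one.
Qed.
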